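(* Let $R$ be a finite-dimensional algebra over a field with infinite dominant dimension. Then the following are equivalent: (i) $R$ is self-injective. (ii) All acyclic complexes of injective $R$-modules are totally acyclic, and all acyclic complexes of injective $R^{op}$-modules are totally acyclic. (iii) All acyclic complexes of projective $R$-modules are totally acyclic, and all acyclic complexes of projective $R^{op}$-modules are totally acyclic. (iv) All acyclic complexes of injective $R$-modules are totally acyclic. (v) All acyclic complexes of projective $R$-modules are totally acyclic. (vi) All acyclic complexes of injective $R^{op}$-modules are totally acyclic. (vii) All acyclic complexes of projective $R^{op}$-modules are totally acyclic.
   Context: ''$R$-module'' means left $R$-module, and $R^{op}$ is the opposite ring, so $R^{op}$-modules are right $R$-modules. Modules are arbitrary (not necessarily finitely generated). A finite-dimensional algebra $R$ has infinite dominant dimension if, in a minimal injective coresolution $0\to R\to E^0(R)\to\cdots\to E^i(R)\to\cdots$ of the $R$-module $R$, all the $E^i(R)$ are projective. $R$ is self-injective if $R$ is injective as an $R$-module. An acyclic (i.e. exact, unbounded in both directions) complex $X^\bullet$ of projective (resp. injective) modules over a ring $S$ (here $S=R$ or $S=R^{op}$) is totally acyclic if $\mathrm{Hom}_S(X^\bullet,M)$ (resp. $\mathrm{Hom}_S(M,X^\bullet)$) is exact for every projective (resp. injective) $S$-module $M$. *)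

(* Defs.v *)
From HB Require Import structures.
From mathcomp Require Import all_boot all_order all_algebra all_field.

Set Implicit Arguments.
Unset Strict Implicit.
Unset Printing Implicit Defensive.

Import GRing.Theory.
Local Open Scope ring_scope.

(* An [S]-module is a left [S]-module, i.e. an [lmodType S]; right modules over *)
(* [S] are left modules over the converse ring [S^c].                           *)

Section Modules.
Variable S : pzRingType.
Implicit Types M N P E : lmodType S.

Definition projective_module P : Prop :=
  forall M N (g : {linear M -> N}) (f : {linear P -> N}),
    (forall y, exists x, g x = y) ->
    exists h : {linear P -> M}, forall x, g (h x) = f x.

Definition injective_module E : Prop :=
  forall M N (g : {linear M -> N}) (f : {linear M -> E}),
    injective g ->
    exists h : {linear N -> E}, forall x, h (g x) = f x.

Definition self_injective : Prop := injective_module S^o.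

Definition is_submodule M (L : M -> Prop) : Prop :=
  [/\ L 0, forall x y, L x -> L y -> L (x + y)
    & forall (a : S) x, L x -> L (a *: x)].

Definition essential M (N : M -> Prop) : Prop :=
  is_submodule N /\
  forall L : M -> Prop, is_submodule L -> (exists2 x, L x & x <> 0) ->
    exists x, [/\ L x, N x & x <> 0].

(* Minimality says that [E 0] is an injective envelope of [M] and [E i.+1] one  *)
(* of the image of [d i]; by exactness these submodules are the kernels of the  *)
(* outgoing maps [d 0] and [d i.+1].                                            *)
Definition minimal_injective_coresolution M (E : nat -> lmodType S)
    (eta : {linear M -> E 0%N}) (d : forall i, {linear E i -> E i.+1}) : Prop :=
  [/\ injective eta,
      forall y, d 0%N y = 0 <-> exists x, eta x = y,
      forall i y, d i.+1 y = 0 <-> exists x, d i x = y,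
      forall i, injective_module (E i)
    & forall i, essential (fun x => d i x = 0)].

(* Minimal injective coresolutions exist and are unique up to isomorphism, so   *)
(* it does not matter which one is used.                                        *)
Definition infinite_dominant_dimension : Prop :=
  exists (E : nat -> lmodType S) (eta : {linear S^o -> E 0%N})
         (d : forall i, {linear E i -> E i.+1}),
    minimal_injective_coresolution eta d /\ forall i, projective_module (E i).

Record complex := Complex {
  cobj :> int -> lmodType S;
  cdiff : forall i, {linear cobj i -> cobj (i + 1)};
  cdiffK : forall i x, cdiff (i + 1) (cdiff i x) = 0 }.

(* Every integer has the form [i + 1], so this is exactness in all degrees; the *)
(* same indexing is used for the Hom complexes below.                           *)
Definition acyclic (X : complex) : Prop :=
  forall i (y : X (i + 1)), cdiff X (i + 1) y = 0 -> exists x, cdiff X i x = y.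

(* Exactness of Hom(X, M) in all degrees *)
Definition exact_Hom_to (X : complex) M : Prop :=
  forall i (f : {linear X (i + 1) -> M}),
    (forall x, f (cdiff X i x) = 0) ->
    exists g : {linear X (i + 1 + 1) -> M},
      forall x, g (cdiff X (i + 1) x) = f x.

(* Exactness of Hom(M, X) in all degrees *)
Definition exact_Hom_from M (X : complex) : Prop :=
  forall i (f : {linear M -> X (i + 1)}),
    (forall x, cdiff X (i + 1) (f x) = 0) ->
    exists g : {linear M -> X i}, forall x, cdiff X i (g x) = f x.

Definition acyclic_complex_of_projectives (X : complex) : Prop :=
  acyclic X /\ forall i, projective_module (X i).

Definition acyclic_complex_of_injectives (X : complex) : Prop :=
  acyclic X /\ forall i, injective_module (X i).

Definition totally_acyclic_projectives (X : complex) : Prop :=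
  acyclic_complex_of_projectives X /\
  forall M, projective_module M -> exact_Hom_to X M.

Definition totally_acyclic_injectives (X : complex) : Prop :=
  acyclic_complex_of_injectives X /\
  forall M, injective_module M -> exact_Hom_from M X.

Definition all_acyclic_projectives_totally_acyclic : Prop :=
  forall X, acyclic_complex_of_projectives X -> totally_acyclic_projectives X.

Definition all_acyclic_injectives_totally_acyclic : Prop :=
  forall X, acyclic_complex_of_injectives X -> totally_acyclic_injectives X.

End Modules.

(* Main.v *)
(* Write D for the duality Hom_K(-, K) between left and right modules.          *)
(*                                                                              *)
(* If R is left self-injective, write l and r for left and right annihilators.  *)
(* Then r(l I) = I for every right ideal I, and r turns finite intersections of *)
(* left ideals into sums; this forces r(L) <> 0 for every proper left ideal L,  *)
(* so that R is a cogenerator. Hence the injective modules are the summands of  *)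
(* the powers R^X, that is (R being finite-dimensional) the projective ones. In *)
(* particular the injective left module D(R) is projective, so R = D(D(R)) is   *)
(* right self-injective, and all the acyclic complexes are totally acyclic.     *)
(*                                                                              *)
(* Conversely let 0 -> R -> E^0 -> E^1 -> ... have all E^i projective and       *)
(* injective. It is an acyclic complex of projectives, and                      *)
(* ... -> D(E^1) -> D(E^0) -> D(R) -> 0 is one of injectives over R^op; the     *)
(* total acyclicity of either one splits R -> E^0. The two remaining conditions *)
(* follow because infinite dominant dimension is left-right symmetric: iterated *)
(* approximations by powers of Q = D(E^0) give a complex F of right modules     *)
(* starting at R, Hom(F, D(E^i)) is exact for all i by construction, hence so   *)
(* is Hom(F, D(R)) = D(F) by dimension shifting, and F is exact.                *)

Require Import Defs.
From HB Require Import structures.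
From mathcomp Require Import all_boot all_order all_algebra all_field.
From mathcomp Require Import boolp classical_sets functions.

Set Implicit Arguments.
Unset Strict Implicit.
Unset Printing Implicit Defensive.

Import GRing.Theory.
Local Open Scope ring_scope.

(** All implications pass through (i). Over a self-injective algebra projective and injective
    modules coincide ([projective_injective], [injective_projective]), so the Hom functors in the
    definition of total acyclicity are exact; and D(R) is then projective, which carries
    self-injectivity to the opposite ring ([self_injective_swap]).

    Conversely, a coresolution of the ring by projective-injective modules, or its dual, is a test
    complex: applying total acyclicity to the identity of R, or of D(R), splits R -> E^0
    ([self_injective_of_projectives], [self_injective_of_opposite_injectives]). A coresolution of R
    settles projectives over R and injectives over the opposite ring; the other two conditions need
    a coresolution of the opposite ring, given by [opposite_coresolution], whose core is
    [tower_exact].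

    Infinitely generated modules are handled by direct powers in place of direct sums: as R is
    finite-dimensional, R^X is projective for every set X, and every projective module is a retract
    of such a power ([projective_power], [projective_sub_power]). *)

Definition lin_of (S : pzRingType) (M N : lmodType S) (f : M -> N)
    (lin_f : linear f) : {linear M -> N} :=
  HB.pack f (GRing.isLinear.Build _ _ _ _ f lin_f).

(** * Injective and projective modules *)

Section Submodules.
Variables (S : pzRingType) (V : lmodType S) (L : V -> Prop).

Definition submod_pred (subL : is_submodule L) : {pred V} := fun x => `[< L x >].

Variable subL : is_submodule L.

Lemma submod_predP x : reflect (L x) (x \in submod_pred subL).
Proof. exact: asboolP. Qed.

Lemma submod_pred_closed : submod_closed (submod_pred subL).
Proof.
have [L0 LD LZ] := subL; split; first exact/submod_predP.
by move=> a x y /submod_predP Lx /submod_predP Ly; apply/submod_predP/LD/Ly/LZ.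
Qed.

HB.instance Definition _ :=
  GRing.isSubmodClosed.Build S V (submod_pred subL) submod_pred_closed.

Definition submod : Type := {x : V | x \in submod_pred subL}.

HB.instance Definition _ := SubChoice.on submod.
HB.instance Definition _ := [SubChoice_isSubLmodule of submod by <:].

Definition submod_val : {linear submod -> V} := val.

Lemma submod_val_inj : injective submod_val. Proof. exact: val_inj. Qed.

Lemma submodP (u : submod) : L (submod_val u).
Proof. by case: u => x /= /submod_predP. Qed.

Definition Submod x (Lx : L x) : submod := exist _ x (introT (submod_predP x) Lx).

End Submodules.

Section InjectiveProjective.
Variable S : pzRingType.
Implicit Types A B E M N P : lmodType S.

(* Extending a partially defined map along its graph avoids building the       *)
(* domain as a module.                                                         *)
Lemma injective_graph E B (G : B -> E -> Prop) : injective_module E ->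
    G 0 0 -> (forall b m b' m', G b m -> G b' m' -> G (b + b') (m + m')) ->
    (forall a b m, G b m -> G (a *: b) (a *: m)) ->
    (forall m, G 0 m -> m = 0) ->
  exists g : {linear B -> E}, forall b m, G b m -> g b = m.
Proof.
move=> injE G0 GD GZ Gfun.
have subG : is_submodule (fun u : (B * E)%type => G u.1 u.2).
  by split=> //= [[b m] [b' m']|a [b m]] /=; [apply: GD | apply: GZ].
pose p : {linear submod subG -> B} := fst \o submod_val subG.
pose q : {linear submod subG -> E} := snd \o submod_val subG.
have p_inj : injective p.
  suff p0 u : p u = 0 -> u = 0.
    by move=> u v /eqP; rewrite -subr_eq0 -linearB => /eqP/p0/eqP;
      rewrite subr_eq0 => /eqP.
  move=> pu0; apply: (@submod_val_inj _ _ _ subG); rewrite linear0.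
  have e1 : (submod_val subG u).1 = 0 by [].
  have := submodP u; rewrite e1 => /Gfun e2.
  by rewrite [LHS]surjective_pairing e1 e2.
have [h hE] := injE _ _ p q p_inj.
exists h => b m Gbm.
have Gu : G (b, m).1 (b, m).2 by [].
exact: (hE (Submod subG Gu)).
Qed.

Lemma injective_factor E A B (d : {linear A -> B}) (f : {linear A -> E}) :
  injective_module E -> (forall x, d x = 0 -> f x = 0) ->
  exists g : {linear B -> E}, forall x, g (d x) = f x.
Proof.
move=> injE df0.
have [||||g gE] := @injective_graph E B (fun b m => exists2 x, d x = b & f x = m) injE.
- by exists 0; rewrite linear0.
- by move=> b m b' m' [x <- <-] [y <- <-]; exists (x + y); rewrite linearD.
- by move=> a b m [x <- <-]; exists (a *: x); rewrite linearZ.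
- by move=> m [x /df0 -> <-].
by exists g => x; apply: gE; exists x.
Qed.

(** The pullback of [f] along [d], a submodule of [P * A], maps onto [P]; a section of this
    projection followed by the second coordinate is the lift. *)
Lemma projective_factor P A B (d : {linear A -> B}) (f : {linear P -> B}) :
  projective_module P -> (forall x, exists y, d y = f x) ->
  exists h : {linear P -> A}, forall x, d (h x) = f x.
Proof.
move=> projP df.
have subL : is_submodule (fun u : (P * A)%type => f u.1 = d u.2).
  split=> [|[x y] [x' y'] /= e e'|a [x y] /= e]; first by rewrite !linear0.
    by rewrite !linearD e e'.
  by rewrite !linearZ /= e.
pose p : {linear submod subL -> P} := fst \o submod_val subL.
pose q : {linear submod subL -> A} := snd \o submod_val subL.
have [x|h hE] := projP _ _ p idfun.
  have [y dy] := df x.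
  have Lu : f (x, y).1 = d (x, y).2 by rewrite dy.
  by exists (Submod subL Lu).
pose qh : {linear P -> A} := q \o h.
exists qh => x; have := submodP (h x).
by rewrite (hE x : (submod_val subL (h x)).1 = x) => /esym.
Qed.

Lemma injective_retract E M (i : {linear E -> M}) (r : {linear M -> E}) :
  cancel i r -> injective_module M -> injective_module E.
Proof.
move=> iK injM A B g f g_inj.
have [h hE] := injM _ _ g (i \o f : {linear A -> M}) g_inj.
by exists (r \o h : {linear B -> E}) => x; rewrite /= hE iK.
Qed.

Lemma projective_retract P M (i : {linear P -> M}) (r : {linear M -> P}) :
  cancel i r -> projective_module M -> projective_module P.
Proof.
move=> iK projM A B g f g_surj.
have [h hE] := projM _ _ g (f \o r : {linear M -> B}) g_surj.
by exists (h \o i : {linear P -> A}) => x; rewrite /= hE /= iK.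
Qed.

Lemma injective_power (X : Type) E : injective_module E -> injective_module (X -> E).
Proof.
move=> injE A B g f g_inj.
have ev x : linear (fun u => f u x) by move=> a u v; rewrite linearP.
have /choice[h hE] : forall x, exists h : {linear B -> E}, forall u, h (g u) = f u x.
  by move=> x; exact: (injE _ _ g (lin_of (ev x)) g_inj).
have lin_h : linear (fun b x => h x b).
  by move=> a u v; apply: funext => x; rewrite linearP.
by exists (lin_of lin_h) => u; apply: funext => x; rewrite /= hE.
Qed.

Lemma injective_split E M (i : {linear E -> M}) :
  injective_module E -> injective i -> exists r : {linear M -> E}, cancel i r.
Proof. by move=> injE i_inj; have [r rE] := injE _ _ i idfun i_inj; exists r. Qed.

End InjectiveProjective.

(** * Vector spaces *)

Section VectorSpaces.
Variable K : fieldType.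
Implicit Types U V : lmodType K.

Lemma subspace_complement V (L : V -> Prop) : is_submodule L ->
  exists C : V -> Prop, [/\ is_submodule C, forall x, C x -> L x -> x = 0
    & forall v, exists l c, [/\ L l, C c & v = l + c]].
Proof.
move=> [L0 LD LZ].
pose good (C : set V) := is_submodule C /\ forall x, C x -> L x -> x = 0.
have LB x y : L x -> L y -> L (x - y).
  by move=> Lx Ly; apply: LD => //; rewrite -scaleN1r; apply: LZ.
(* Adjoining 0 to every set makes the empty chain, whose union is empty, harmless. *)
have [F Fgood Ftot|C [[[C0 CD CZ] CL] Cmax]] :=
    @Zorn_bigcup V [set C | good ([set 0] `|` C)%classic].
  split; last first.
    by move=> x [-> //|[C FC Cx] Lx]; have [_] := Fgood _ FC; apply=> //; right.
  split; first by left.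
    move=> x y [->|[C FC Cx]]; first by rewrite add0r.
    move=> [->|[D FD Dy]]; first by rewrite addr0; right; exists C.
    have [[_ CD _] _] := Fgood _ FC; have [[_ DD _] _] := Fgood _ FD.
    case: (Ftot _ _ FC FD) => [/(_ _ Cx) Dx|/(_ _ Dy) Cy].
      have [] := DD x y (or_intror Dx) (or_intror Dy); first by left.
      by right; exists D.
    have [] := CD x y (or_intror Cx) (or_intror Cy); first by left.
    by right; exists C.
  move=> a x [->|[C FC Cx]]; first by rewrite scaler0; left.
  have [[_ _ CZ] _] := Fgood _ FC.
  by have [] := CZ a x (or_intror Cx); [left | right; exists C].
exists ([set 0] `|` C)%classic; split=> // v; apply: contrapT => Nv.
(* The span of [v] and [C]. It still meets [L] trivially: an element of it in [L] with nonzero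
   coefficient at [v] would put [v] in [L + C]. *)
pose D := [set x | exists a c, ([set 0] `|` C)%classic c /\ x = a *: v + c]%classic.
have CsubD c : ([set 0] `|` C)%classic c -> D c.
  by move=> Cc; exists 0, c; rewrite scale0r add0r.
apply: (Cmax D).
  split; first by move=> c Cc; apply: CsubD; right.
  move=> /(_ v) DC; have Cv : C v.
    by apply: DC; exists 1, 0; rewrite scale1r addr0; split.
  by apply: Nv; exists 0, v; split; rewrite ?add0r //; right.
have Dequiv x : ([set 0] `|` D)%classic x -> D x.
  by move=> [->|//]; apply: CsubD.
split; last first.
  move=> x /Dequiv[a [c [Cc ->]]] Lx.
  have [a0|a0] := eqVneq a 0.
    by move: Lx; rewrite a0 scale0r add0r; apply: CL.
  exfalso; apply: Nv; exists (a^-1 *: (a *: v + c)), (- a^-1 *: c); split.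
  - exact: LZ.
  - exact: CZ.
  - by rewrite scalerDr scalerA mulVf // scale1r scaleNr addrK.
split; first by left.
  move=> _ _ /Dequiv[a [c [Cc ->]]] /Dequiv[b [d [Cd ->]]]; right.
  exists (a + b), (c + d); split; first exact: CD.
  by rewrite scalerDl addrACA.
move=> k _ /Dequiv[a [c [Cc ->]]]; right.
by exists (k * a), (k *: c); split; [exact: CZ | rewrite scalerDr scalerA].
Qed.

Lemma subspace_projection V (L : V -> Prop) : is_submodule L ->
  exists p : {linear V -> V}, (forall x, L (p x)) /\ (forall x, L x -> p x = x).
Proof.
move=> subL; have [C [[C0 CD CZ] CL CT]] := subspace_complement subL.
have [L0 LD LZ] := subL.
have LB x y : L x -> L y -> L (x - y).
  by move=> Lx Ly; apply: LD => //; rewrite -scaleN1r; apply: LZ.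
have uniq l c l' c' : L l -> C c -> L l' -> C c' -> l + c = l' + c' -> l = l'.
  move=> Ll Cc Ll' Cc' e; apply/eqP; rewrite -subr_eq0; apply/eqP/CL; last exact: LB.
  have -> : l - l' = c' - c.
    by apply/eqP; rewrite subr_eq eq_sym addrAC subr_eq addrC e.
  by apply: CD => //; rewrite -scaleN1r; apply: CZ.
have /choice[p pP] : forall v, exists l, L l /\ exists2 c, C c & v = l + c.
  by move=> v; have [l [c [Ll Cc ->]]] := CT v; exists l; split=> //; exists c.
have lin_p : linear p.
  move=> a u v; have [Lu [c Cc eu]] := pP u; have [Lv [d Cd ev]] := pP v.
  have [Lw [e Ce ew]] := pP (a *: u + v).
  apply: (uniq _ e _ (a *: c + d)) => //; try by [apply: LD => //; apply: LZ | apply: CD => //; apply: CZ].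
  by rewrite -ew {1}eu {1}ev scalerDr addrACA.
exists (lin_of lin_p); split=> [x|x Lx /=]; first by have [] := pP x.
have [Lp [c Cc e]] := pP x.
by apply/esym/(uniq _ 0 _ c) => //; rewrite addr0.
Qed.

(** Linear maps over a field are von Neumann regular in any dimension. Preimages [s] are chosen
    arbitrarily; removing their component in the kernel makes the result independent of the choice,
    hence linear. One such [q] serves both as section of a surjection and as retraction of an
    injection. *)
Lemma regular_inverse U V (d : {linear U -> V}) :
  exists q : {linear V -> U}, forall x, d (q (d x)) = d x.
Proof.
have subker : is_submodule (fun x => d x = 0).
  split=> [|x y dx dy|a x dx]; rewrite ?linear0 ?linearD ?linearZ //= ?dx ?dy ?addr0 //.
  exact: scaler0.
have subim : is_submodule (fun y => exists x, d x = y).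
  split=> [|_ _ [x <-] [y <-]|a _ [x <-]]; first by exists 0; rewrite linear0.
    by exists (x + y); rewrite linearD.
  by exists (a *: x); rewrite linearZ.
have [p [pker pid]] := subspace_projection subker.
have [r [rim rid]] := subspace_projection subim.
have [s sE] := choice rim.
have dp x y : d x = d y -> x - p x = y - p y.
  move=> e; have : p (x - y) = x - y by apply: pid; rewrite linearB /= e subrr.
  rewrite linearB /= => e'; apply/eqP.
  by rewrite subr_eq -addrA [- p y + _]addrC e' addrC subrK.
have lin_q : linear (fun v => s v - p (s v)).
  move=> a u v.
  have -> : s (a *: u + v) - p (s (a *: u + v))
          = (a *: s u + s v) - p (a *: s u + s v).
    by apply: dp; rewrite sE !linearP /= !sE.
  by rewrite linearP /= scalerBr opprD addrACA.
exists (lin_of lin_q) => x /=.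
by rewrite linearB /= pker subr0 sE rid //; exists x.
Qed.

End VectorSpaces.

(** * Duality over a finite-dimensional algebra *)

(* A finite-dimensional algebra presented together with a copy of its opposite *)
(* ring: [swap] exchanges the two sides definitionally, whereas [R^c^c] is not *)
(* convertible to [R] as a ring. The family [basis] need not be free.          *)
Record opposite_algebras (K : fieldType) := OppositeAlgebras {
  lring : pzRingType;
  rring : pzRingType;
  rtol : rring -> lring;
  ltor : lring -> rring;
  rtolK : cancel rtol ltor;
  ltorK : cancel ltor rtol;
  rtolD : forall x y, rtol (x + y) = rtol x + rtol y;
  rtol1 : rtol 1 = 1;
  rtolM : forall x y, rtol (x * y) = rtol y * rtol x;
  emb : K -> lring;
  embD : forall k l, emb (k + l) = emb k + emb l;
  emb1 : emb 1 = 1;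
  embM : forall k l, emb (k * l) = emb k * emb l;
  embC : forall k x, emb k * x = x * emb k;
  adim : nat;
  basis : 'I_adim -> lring;
  coord : 'I_adim -> lring -> K;
  coordD : forall i x y, coord i (x + y) = coord i x + coord i y;
  coordZ : forall i k x, coord i (emb k * x) = k * coord i x;
  basisE : forall x, x = \sum_i emb (coord i x) * basis i }.

Arguments ltor {K} A _ : rename.
Arguments emb {K} A _ : rename.
Arguments basis {K} A _ : rename.
Arguments coord {K} A _ _ : rename.

Section Swap.
Variables (K : fieldType) (A : opposite_algebras K).

Lemma emb0 : emb A 0 = 0.
Proof. by apply: (addrI (emb A 0)); rewrite -embD !addr0. Qed.

Lemma coord0 i : coord A i 0 = 0.
Proof. by apply: (addrI (coord A i 0)); rewrite -coordD !addr0. Qed.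

Lemma ltorD x y : ltor A (x + y) = ltor A x + ltor A y.
Proof. by apply: (can_inj (@rtolK _ A)); rewrite rtolD !ltorK. Qed.

Lemma ltor1 : ltor A 1 = 1.
Proof. by apply: (can_inj (@rtolK _ A)); rewrite ltorK rtol1. Qed.

Lemma ltorM x y : ltor A (x * y) = ltor A y * ltor A x.
Proof. by apply: (can_inj (@rtolK _ A)); rewrite rtolM !ltorK. Qed.

Lemma ltor0 : ltor A 0 = 0.
Proof. by apply: (addrI (ltor A 0)); rewrite -ltorD !addr0. Qed.

Lemma ltor_sum n (F : 'I_n -> lring A) :
  ltor A (\sum_i F i) = \sum_i ltor A (F i).
Proof. exact: (big_morph _ ltorD ltor0). Qed.

Definition swap : opposite_algebras K.
Proof.
refine (@OppositeAlgebras K (rring A) (lring A) (@ltor _ A) (@rtol _ A)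
  (@ltorK _ A) (@rtolK _ A) ltorD ltor1 ltorM (@ltor _ A \o @emb _ A) _ _ _ _
  (adim A) (@ltor _ A \o @basis _ A) (fun i => @coord _ A i \o @rtol _ A) _ _ _).
- by move=> k l; rewrite /= embD ltorD.
- by rewrite /= emb1 ltor1.
- by move=> k l; rewrite /= embM embC ltorM.
- by move=> k x; rewrite /= -{1 2}(rtolK x) -!ltorM embC.
- by move=> i x y; rewrite /= rtolD coordD.
- by move=> i k x; rewrite /= rtolM ltorK -embC coordZ.
- move=> x; rewrite -{1}(rtolK x) {1}[rtol x]basisE ltor_sum.
  by apply: eq_bigr => i _; rewrite /= embC ltorM.
Defined.

End Swap.

(** * Restriction of scalars to the field, and the dual module *)

Section Scalars.
Variables (K : fieldType) (A : opposite_algebras K).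
Local Notation S := (lring A).
Implicit Types M N P : lmodType S.

Definition scalars M : Type := M.
HB.instance Definition _ M := GRing.Zmodule.on (scalars M).

Section Instance.
Variable M : lmodType S.
Definition scalars_scale (k : K) (x : scalars M) : scalars M := emb A k *: (x : M).
Lemma scalars_scaleA k l x :
  scalars_scale k (scalars_scale l x) = scalars_scale (k * l) x.
Proof. by rewrite /scalars_scale scalerA embM. Qed.
Lemma scalars_scale1 : left_id 1 scalars_scale.
Proof. by move=> x; rewrite /scalars_scale emb1 scale1r. Qed.
Lemma scalars_scaleDr : right_distributive scalars_scale +%R.
Proof. by move=> k x y; exact: scalerDr. Qed.
Lemma scalars_scaleDl x : {morph scalars_scale^~ x : k l / k + l}.
Proof. by move=> k l; rewrite /scalars_scale embD scalerDl. Qed.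
HB.instance Definition _ := GRing.Zmodule_isLmodule.Build K (scalars M)
  scalars_scaleA scalars_scale1 scalars_scaleDr scalars_scaleDl.
End Instance.

Definition K_linear M N (f : M -> N) :=
  (forall x y, f (x + y) = f x + f y) /\
  (forall k x, f (emb A k *: x) = emb A k *: f x).

Lemma linear_K_linear M N (f : {linear M -> N}) : K_linear f.
Proof. by split=> *; rewrite ?linearD ?linearZ. Qed.

Lemma K_linear_comp M N P (g : N -> P) (f : M -> N) :
  K_linear g -> K_linear f -> K_linear (g \o f).
Proof. by move=> [gD gZ] [fD fZ]; split=> *; rewrite /= ?fD ?fZ ?gD ?gZ. Qed.

Definition scalars_lin M N (f : M -> N) (linf : K_linear f) :
  {linear scalars M -> scalars N}.
Proof.
apply: (@lin_of K (scalars M) (scalars N) f) => k x y.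
by case: linf => fD fZ; rewrite fD; congr (_ + _); apply: fZ.
Defined.

Lemma K_linear_regular M N (d : M -> N) : K_linear d ->
  exists2 q : N -> M, K_linear q & forall x, d (q (d x)) = d x.
Proof.
move=> lind; have [q qE] := regular_inverse (scalars_lin lind).
exists (q : N -> M); last exact: qE.
by split=> [x y|k x]; [exact: (linearD q) | exact: (linearZ_LR q)].
Qed.

Lemma K_linear_sum M N (f : M -> N) : K_linear f ->
  forall (I : finType) (F : I -> M), f (\sum_i F i) = \sum_i f (F i).
Proof.
move=> [fD _] I F; apply: big_morph => //.
by apply: (addrI (f 0)); rewrite -fD !addr0.
Qed.

Definition dual_pred M : {pred M -> K^o} := fun f =>
  `[< (forall x y, f (x + y) = f x + f y) /\
      (forall k x, f (emb A k *: x) = k * f x) >].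

Lemma dual_pred_closed M : submod_closed (@dual_pred M).
Proof.
split; first by apply/asboolP; split=> *; rewrite ?addr0 ?mulr0.
move=> a f g /asboolP[fD fZ] /asboolP[gD gZ]; apply/asboolP.
split=> [x y|k x]; rewrite !fctE.
  by rewrite fD gD scalerDr addrACA.
by rewrite fZ gZ scalerAr mulrDr.
Qed.

HB.instance Definition _ M :=
  GRing.isSubmodClosed.Build K (M -> K^o) (@dual_pred M) (@dual_pred_closed M).

Definition dual M : Type := {f : M -> K^o | f \in @dual_pred M}.
HB.instance Definition _ M := SubChoice.on (dual M).
HB.instance Definition _ M := [SubChoice_isSubZmodule of dual M by <:].

Definition dual_fun M (f : dual M) : M -> K := val f.
Coercion dual_fun : dual >-> Funclass.

Section DualTheory.
Variable M : lmodType S.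
Implicit Types f g : dual M.

Lemma dualP f g : f =1 g -> f = g.
Proof. by move=> e; apply: val_inj; apply: funext. Qed.

Lemma dualD f x y : f (x + y) = f x + f y.
Proof. by have /asboolP[fD _] := valP f; apply: fD. Qed.

Lemma dualZ f k x : f (emb A k *: x) = k * f x.
Proof. by have /asboolP[_ fZ] := valP f; apply: fZ. Qed.

Lemma dual0 f : f 0 = 0.
Proof. by apply: (addrI (f 0)); rewrite -dualD !addr0. Qed.

Lemma dualN f x : f (- x) = - f x.
Proof. by apply/eqP; rewrite -addr_eq0 -dualD addNr dual0. Qed.

Lemma dualB f x y : f (x - y) = f x - f y.
Proof. by rewrite dualD dualN. Qed.

Lemma dual_sum f (I : finType) (F : I -> M) : f (\sum_i F i) = \sum_i f (F i).
Proof. exact: (big_morph _ (dualD f) (dual0 f)). Qed.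

Lemma add_dualE f g x : (f + g : dual M) x = f x + g x. Proof. by []. Qed.

Lemma zero_dualE x : (0 : dual M) x = 0. Proof. by []. Qed.

Lemma sum_dualE (I : finType) (F : I -> dual M) x : (\sum_i F i : dual M) x = \sum_i F i x.
Proof. exact: (big_morph (fun f : dual M => f x) (fun f g => add_dualE f g x)). Qed.

Definition Dual (f : M -> K) (fD : forall x y, f (x + y) = f x + f y)
    (fZ : forall k x, f (emb A k *: x) = k * f x) : dual M :=
  exist _ f (asboolT (conj fD fZ)).

Lemma DualE (u : M -> K) uD uZ x : @Dual u uD uZ x = u x. Proof. by []. Qed.

Definition dual_scale (t : rring A) f : dual M.
Proof.
apply: (@Dual (fun x => f (rtol t *: x))) => [x y|k x].
  by rewrite scalerDr dualD.
by rewrite scalerA -embC -scalerA dualZ.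
Defined.

Lemma dual_scaleE t f x : dual_scale t f x = f (rtol t *: x). Proof. by []. Qed.
Lemma dual_scaleA t u f : dual_scale t (dual_scale u f) = dual_scale (t * u) f.
Proof. by apply: dualP => x; rewrite !dual_scaleE scalerA rtolM. Qed.
Lemma dual_scale1 : left_id 1 dual_scale.
Proof. by move=> f; apply: dualP => x; rewrite dual_scaleE rtol1 scale1r. Qed.
Lemma dual_scaleDr : right_distributive dual_scale +%R.
Proof. by move=> t f g; apply: dualP. Qed.
Lemma dual_scaleDl f : {morph dual_scale^~ f : t u / t + u}.
Proof.
move=> t u; apply: dualP => x.
by rewrite add_dualE !dual_scaleE rtolD scalerDl dualD.
Qed.

HB.instance Definition _ := GRing.Zmodule_isLmodule.Build (rring A) (dual M)
  dual_scaleA dual_scale1 dual_scaleDr dual_scaleDl.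

Lemma scale_dualE t f x : (t *: f : dual M) x = f (rtol t *: x). Proof. by []. Qed.

End DualTheory.

Lemma dual_extend M N (d : {linear M -> N}) (f : dual M) :
  (forall x, d x = 0 -> f x = 0) -> exists g : dual N, forall x, g (d x) = f x.
Proof.
move=> df0; have [q [qD qZ] dq] := K_linear_regular (linear_K_linear d).
have fqD x y : f (q (x + y)) = f (q x) + f (q y) by rewrite qD dualD.
have fqZ k x : f (q (emb A k *: x)) = k * f (q x) by rewrite qZ dualZ.
exists (Dual fqD fqZ) => x; rewrite DualE; apply/eqP; rewrite -subr_eq0 -dualB.
by rewrite df0 // linearB /= dq subrr.
Qed.

(** With [q] a regular inverse of [d], the map [x - d (q x)] kills the image of [d] but not [y]; [f]
    is this map followed by a functional equal to 1 on its value at [y]. *)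
Lemma dual_separates M N (d : {linear M -> N}) y : (~ exists x, d x = y) ->
  exists2 f : dual N, (forall x, f (d x) = 0) & f y != 0.
Proof.
move=> Ny; have [q linq dq] := K_linear_regular (linear_K_linear d).
have [qD qZ] := linq.
pose z : scalars N := y - d (q y).
have z0 : z != 0.
  by apply/eqP => /eqP; rewrite subr_eq0 => /eqP e; apply: Ny; exists (q y).
have lin_z : linear (fun k : K^o => k *: z).
  by move=> a k l; rewrite scalerDl scalerA.
have [r rE] := regular_inverse (lin_of lin_z).
have rz : r z = 1.
  have := rE 1; rewrite /= scale1r => /eqP; rewrite -subr_eq0 -[X in _ - X]scale1r.
  by rewrite -scalerBl scaler_eq0 (negPf z0) orbF subr_eq0 => /eqP.
pose f x : K := r (x - d (q x)).
have fD x x' : f (x + x') = f x + f x'.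
  by rewrite /f qD (linearD d) opprD addrACA; exact: (linearD r).
have fZ k x : f (emb A k *: x) = k * f x.
  rewrite /f qZ (linearZ_LR d) -scalerBr; exact: (linearZ_LR r).
exists (Dual fD fZ) => [x|]; last by rewrite DualE /f -/z rz oner_neq0.
by rewrite DualE /f dq subrr; exact: (linear0 r).
Qed.

End Scalars.

Lemma linear_bijection (S : pzRingType) (M N : lmodType S) (d : {linear M -> N}) :
  injective d -> (forall y, exists x, d x = y) ->
  exists2 r : {linear N -> M}, cancel d r & cancel r d.
Proof.
move=> d_inj /choice[r rE].
have lin_r : linear r by move=> a x y; apply: d_inj; rewrite linearP !rE.
by exists (lin_of lin_r) => // x; apply: d_inj; exact: rE.
Qed.

Section DualMap.
Variables (K : fieldType) (A : opposite_algebras K).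
Variables (M N : lmodType (lring A)) (d : {linear M -> N}).

Definition dual_map_fun (f : dual N) : dual M.
Proof.
apply: (@Dual _ _ M (fun x => f (d x))) => [x y|k x].
  by rewrite linearD dualD.
by rewrite linearZ dualZ.
Defined.

Lemma dual_map_linear : linear dual_map_fun.
Proof.
move=> a f g; apply: dualP => x.
by rewrite add_dualE scale_dualE !DualE add_dualE scale_dualE linearZ.
Qed.

Definition dual_map : {linear dual N -> dual M} := lin_of dual_map_linear.

Lemma dual_mapE (f : dual N) x : (dual_map f : dual M) x = f (d x). Proof. by []. Qed.

End DualMap.

(** * Adjunction, reflexivity and projectivity of direct powers *)

Section DualFunctor.
Variables (K : fieldType) (A : opposite_algebras K).
Local Notation S := (lring A).
Local Notation T := (rring A).

Definition codual (N : lmodType T) : lmodType S :=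
  (@dual K (swap A) N : lmodType (rring (swap A))).

Section Flip.
Variables (M : lmodType S) (N : lmodType T).

(** Half of the adjunction between the two dualities: Hom(N, D(M)) and Hom(M, D(N)) both consist of
    the balanced pairings of [M] and [N] into [K]. *)
Lemma flip_in (f : {linear N -> dual M}) :
  exists g : {linear M -> codual N}, forall x y, (g x : @dual K (swap A) N) y = (f y : dual M) x.
Proof.
have gD x y y' : (f (y + y') : dual M) x = (f y : dual M) x + (f y' : dual M) x by rewrite linearD.
have gZ x k y : (f (ltor A (emb A k) *: y) : dual M) x = k * (f y : dual M) x.
  by rewrite linearZ /= scale_dualE ltorK dualZ.
pose g x : @dual K (swap A) N := @Dual _ (swap A) N (fun y => (f y : dual M) x) (gD x) (gZ x).
have lin_g : linear (g : M -> codual N).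
  move=> a x x'; apply: dualP => y.
  rewrite add_dualE scale_dualE !DualE dualD; congr (_ + _).
  by rewrite linearZ /= scale_dualE ltorK.
by exists (lin_of lin_g).
Qed.

Lemma flip_out (g : {linear M -> codual N}) :
  exists f : {linear N -> dual M}, forall x y, (f y : dual M) x = (g x : @dual K (swap A) N) y.
Proof.
pose g' x : @dual K (swap A) N := g x.
have fD y x x' : g' (x + x') y = g' x y + g' x' y by rewrite /g' linearD.
have fZ y k x : g' (emb A k *: x) y = k * g' x y.
  rewrite /g' linearZ; exact: (dualZ (g' x) k y).
pose f y : dual M := Dual (fD y) (fZ y).
have lin_f : linear f.
  move=> a y y'; apply: dualP => x.
  rewrite add_dualE scale_dualE !DualE dualD; congr (_ + _).
  by rewrite /g' linearZ /= -[in LHS](rtolK a).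
by exists (lin_of lin_f).
Qed.

End Flip.

Lemma dual_map_codual (N N' : lmodType T) (g : {linear N -> N'}) :
  exists2 h : {linear codual N' -> codual N},
    forall (f : @dual K (swap A) N') y, (h f : @dual K (swap A) N) y = f (g y) &
    injective g -> forall f, exists f', h f' = f.
Proof.
exists (@dual_map K (swap A) N N' g : {linear codual N' -> codual N}) => //.
move=> g_inj f.
have [x gx|f' f'E] := @dual_extend K (swap A) N N' g f.
  by rewrite (g_inj x 0) ?dual0 // gx linear0.
by exists f'; apply: dualP.
Qed.

(** Under the adjunction, extending [f] along the injection [g] becomes lifting a map out of [M]
    along the surjective dual of [g]. *)
Lemma dual_injective (M : lmodType S) :
  projective_module M -> injective_module (dual M).
Proof.
move=> projM N N' g f g_inj; have [f' f'E] := flip_in f.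
have [gt gtE /(_ g_inj) gt_surj] := dual_map_codual g.
have [h hE] := projM _ _ gt f' gt_surj.
have [h' h'E] := flip_out h.
exists h' => y; apply: dualP => x.
by rewrite h'E -gtE hE f'E.
Qed.

(** Encodes finite dimension over [K]; the family [e] need not be free. *)
Definition dual_basis (M : lmodType S) (I : finType) (e : I -> M) (c : I -> dual M) :=
  forall x, x = \sum_i emb A (c i x) *: e i.

(** The functionals [c] span the dual, so [F] is determined by the scalars [F (c i)]. Homogeneity of
    [F] is phrased through values, which avoids fixing a [K]-action on the dual. *)
Lemma dual_reflexive (M : lmodType S) (I : finType) (e : I -> M) (c : I -> dual M)
    (F : dual M -> K) : dual_basis e c ->
  (forall f g, F (f + g) = F f + F g) ->
  (forall k (f g : dual M), (forall x, g x = k * f x) -> F g = k * F f) ->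
  exists x, forall f : dual M, F f = f x.
Proof.
move=> ec FD FZ; exists (\sum_i emb A (F (c i)) *: e i) => f.
have F0 : F 0 = 0 by apply: (addrI (F 0)); rewrite -FD !addr0.
have -> : f = \sum_i (ltor A (emb A (f (e i)))) *: c i.
  apply: dualP => x; rewrite {1}(ec x) dual_sum sum_dualE.
  by apply: eq_bigr => i _; rewrite dualZ scale_dualE ltorK dualZ mulrC.
rewrite (big_morph _ FD F0) sum_dualE; apply: eq_bigr => i _.
rewrite (FZ (f (e i)) (c i)); last by move=> x; rewrite scale_dualE ltorK dualZ.
rewrite scale_dualE ltorK dualZ dual_sum; congr (_ * _).
have {1}-> : c i = \sum_j ltor A (emb A (c i (e j))) *: c j.
  apply: dualP => x; rewrite {1}(ec x) dual_sum sum_dualE.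
  by apply: eq_bigr => j _; rewrite dualZ scale_dualE ltorK dualZ mulrC.
rewrite (big_morph _ FD F0); apply: eq_bigr => j _.
rewrite dualZ mulrC; apply: FZ => x; by rewrite scale_dualE ltorK dualZ.
Qed.

Lemma ring_dual_basis : exists e c, @dual_basis S^o 'I_(adim A) e c.
Proof.
pose c i : dual S^o := @Dual _ A S^o (coord A i) (@coordD _ A i) (@coordZ _ A i).
exists (basis A : _ -> S^o), c => x; exact: basisE.
Qed.

Lemma power_dual_basis n :
  exists e c, @dual_basis ('I_n -> S^o) ('I_n * 'I_(adim A))%type e c.
Proof.
have cD (p : 'I_n * 'I_(adim A)) (x y : 'I_n -> S^o) :
  coord A p.2 ((x + y) p.1) = coord A p.2 (x p.1) + coord A p.2 (y p.1).
  exact: coordD.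
have cZ (p : 'I_n * 'I_(adim A)) k (x : 'I_n -> S^o) :
  coord A p.2 ((emb A k *: x) p.1) = k * coord A p.2 (x p.1).
  exact: coordZ.
exists (fun p i => (basis A p.2 *+ (p.1 == i) : S^o)), (fun p => Dual (cD p) (cZ p)).
move=> x; apply: funext => i; rewrite fct_sumE.
rewrite (eq_bigr (fun p => emb A (coord A p.2 (x p.1)) * basis A p.2 *+ (p.1 == i)));
  last by move=> p _; rewrite -mulrnAr.
rewrite -(pair_bigA _ (fun j k => emb A (coord A k (x j)) * basis A k *+ (j == i))) /=.
rewrite (bigD1 i) //= [X in _ + X]big1 ?addr0.
  by rewrite {1}(basisE (x i)); apply: eq_bigr => k _; rewrite eqxx.
by move=> j /negPf jni; apply: big1 => k _; rewrite jni.
Qed.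

(** Since [S] is finite-dimensional, S^X is the tensor product of [S] with K^X; this is the
    [S]-linear extension of the restriction of [t] to K^X. *)
Definition S_lift (X : Type) (N : lmodType S) (t : (X -> S^o) -> N) (u : X -> S^o) :=
  \sum_i basis A i *: t (fun x => emb A (coord A i (u x))).

Lemma S_lift_linear X (N : lmodType S) (t : (X -> S^o) -> N) : K_linear t -> linear (S_lift t).
Proof.
move=> lint a u v; have [tD tZ] := lint.
have emb_sum n (F : 'I_n -> K) : emb A (\sum_i F i) = \sum_i emb A (F i).
  exact: (big_morph _ (@embD _ A) (emb0 A)).
pose ui j x : S^o := emb A (coord A j (u x)).
have key i : t (fun x => emb A (coord A i ((a *: u + v) x))) =
    \sum_j emb A (coord A i (a * basis A j)) *: t (ui j)
    + t (fun x => emb A (coord A i (v x))).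
  rewrite -(eq_bigr _ (fun j _ => tZ _ _)) -(K_linear_sum lint) -tD; congr t.
  apply: funext => x; rewrite !fctE coordD embD fct_sumE; congr (_ + _).
  rewrite {1}(basisE (u x)) scaler_sumr.
  rewrite (big_morph _ (@coordD _ A i) (coord0 i)) emb_sum.
  apply: eq_bigr => j _; rewrite /ui scalrfctE.
  have -> : a *: (emb A (coord A j (u x)) * basis A j : S^o)
          = emb A (coord A j (u x)) * (a * basis A j).
    by rewrite -[LHS]/(a * (emb A (coord A j (u x)) * basis A j)) mulrA -embC -mulrA.
  by rewrite coordZ mulrC embM.
rewrite /S_lift (eq_bigr _ (fun i _ => congr1 _ (key i))).
under eq_bigr do rewrite scalerDr.
rewrite big_split /=; congr (_ + _).
under eq_bigr do rewrite scaler_sumr.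
rewrite exchange_big scaler_sumr; apply: eq_bigr => j _.
rewrite scalerA {2}(basisE (a * basis A j)) scaler_suml.
by apply: eq_bigr => i _; rewrite scalerA embC.
Qed.

Lemma S_lift_emb X (N : lmodType S) (t : (X -> S^o) -> N) (v : X -> K) : K_linear t ->
  S_lift t (fun x => emb A (v x)) = t (fun x => emb A (v x)).
Proof.
move=> lint; have [_ tZ] := lint.
have coord_emb i k : coord A i (emb A k) = k * coord A i 1.
  by rewrite -coordZ mulr1.
rewrite /S_lift.
under eq_bigr => i _.
  have -> : (fun x => emb A (coord A i (emb A (v x)))) =
     emb A (coord A i 1) *: ((fun x => emb A (v x)) : X -> S^o).
    by apply: funext => x; rewrite coord_emb mulrC embM.
  rewrite tZ scalerA -embC; over.
by rewrite -scaler_suml -basisE scale1r.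
Qed.

(** A [K]-linear section of [g] after [f] is a lift that need not be [S]-linear; its [S_lift] is
    [S]-linear and remains a lift because [g] and [f] are. *)
Lemma projective_power X : projective_module (X -> S^o).
Proof.
move=> M N g f g_surj.
have [q linq gqg] := K_linear_regular (linear_K_linear g).
have gq y : g (q y) = y by have [x <-] := g_surj y; rewrite gqg.
have lint := K_linear_comp linq (linear_K_linear f).
exists (lin_of (S_lift_linear lint)) => u /=.
rewrite /S_lift linear_sum [in RHS](_ : u = \sum_i basis A i *:
    ((fun x => emb A (coord A i (u x))) : X -> S^o)); last first.
  apply: funext => x; rewrite fct_sumE {1}(basisE (u x)).
  by apply: eq_bigr => i _; rewrite embC.
rewrite linear_sum; apply: eq_bigr => i _.
by rewrite !linearZ /= gq.
Qed.

Lemma dual_eq (M : lmodType S) (x y : M) : (forall f : dual M, f x = f y) -> x = y.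
Proof.
move=> fxy; apply: contrapT => /eqP; rewrite -subr_eq0 => /eqP xy.
have [|f _] := @dual_separates _ _ M M \0 (x - y).
  by move=> [z /esym].
by rewrite dualB fxy subrr eqxx.
Qed.

Lemma emb_dual_eq (M : lmodType S) (x y : M) :
  (forall f : dual M, emb A (f x) = emb A (f y)) -> x = y.
Proof.
move=> fxy; apply: dual_eq => f; apply: contrapT => /eqP; rewrite -subr_eq0 => nz.
have e : emb A (f x - f y) = 0.
  apply/(addIr (emb A (f y))); rewrite -embD subrK fxy add0r //.
(* If [emb] identifies two distinct scalars, the ring is zero and so is [M]. *)
have one0 : (1 : S) = 0 by rewrite -(emb1 A) -(mulVf nz) embM e mulr0.
have z0 (z : M) : z = 0 by rewrite -(scale1r z) one0 scale0r.
by move: nz; rewrite (z0 x) (z0 y) subrr eqxx.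
Qed.

(** The functionals embed [P] [K]-linearly in the power of [S] indexed by [dual P]. The [S_lift] of
    a [K]-linear retraction is an [S]-linear surjection onto [P], which splits. *)
Lemma projective_sub_power (P : lmodType S) : projective_module P ->
  exists X (i : {linear P -> (X -> S^o)}) (r : {linear (X -> S^o) -> P}), cancel i r.
Proof.
move=> projP.
pose j (x : P) : dual P -> S^o := fun f => emb A (f x).
have linj : K_linear (j : P -> (dual P -> S^o)).
  by split=> [x y|k x]; apply: funext => f; rewrite /j ?dualD ?dualZ ?embD ?embM.
have [q linq jqj] := K_linear_regular linj.
have qj x : q (j x) = x.
  by apply: emb_dual_eq => f; exact: (congr1 (fun u => u f) (jqj x)).
have [|i iE] := projP _ _ (lin_of (S_lift_linear linq)) idfun.
  by move=> x; exists (j x); rewrite /= /j S_lift_emb // qj.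
by exists (dual P), i, (lin_of (S_lift_linear linq)).
Qed.

Lemma projective_power_power X Y : projective_module (X -> (Y -> S^o)).
Proof.
have lin_c : linear (fun (u : X -> (Y -> S^o)) (p : X * Y) => u p.1 p.2 : S^o).
  by move=> a u v; apply: funext.
have lin_u : linear (fun (u : X * Y -> S^o) x y => u (x, y) : S^o).
  by move=> a u v; apply: funext => x; apply: funext.
by apply: (@projective_retract _ _ _ (lin_of lin_c) (lin_of lin_u)) => //;
  apply: projective_power.
Qed.

Lemma projective_power_retract X n (P : lmodType S)
    (i : {linear P -> ('I_n -> S^o)}) (r : {linear ('I_n -> S^o) -> P}) :
  cancel i r -> projective_module (X -> P).
Proof.
move=> iK.
have lin_i : linear (fun (u : X -> P) x => i (u x)).
  by move=> a u v; apply: funext => x; rewrite linearP.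
have lin_r : linear (fun (u : X -> ('I_n -> S^o)) x => r (u x)).
  by move=> a u v; apply: funext => x; rewrite linearP.
apply: (@projective_retract _ _ _ (lin_of lin_i) (lin_of lin_r)).
  by move=> u; apply: funext => x; rewrite /= iK.
exact: projective_power_power.
Qed.

End DualFunctor.

Section Bidual.
Variables (K : fieldType) (A : opposite_algebras K).

Lemma bidual (N : lmodType (rring A)) (I : finType) e c :
    @dual_basis K (swap A) N I e c ->
  exists (i : {linear N -> dual (codual N)}) (r : {linear dual (codual N) -> N}),
    cancel i r /\ cancel r i.
Proof.
move=> ec; have [i iE] := flip_out (idfun : {linear codual N -> codual N}).
have i_inj : injective i.
  move=> x y ixy; apply: (@dual_eq K (swap A)) => f.
  by rewrite -[LHS](iE f x) ixy (iE f y).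
have [y|r ir ri] := linear_bijection i_inj; last by exists i, r.
pose F (f : @dual K (swap A) N) : K := (y : dual (codual N)) (f : codual N).
have [|k f g fg|x xE] := dual_reflexive (F := F) ec.
- exact: (dualD (y : dual (codual N))).
- rewrite /F -(dualZ (y : dual (codual N))); congr dual_fun.
  apply: dualP => x; rewrite scale_dualE fg; exact/esym/(dualZ f k x).
exists x; apply: dualP => f; exact: (etrans (iE f x) (esym (xE f))).
Qed.

End Bidual.

(** * Self-injective algebras *)

Section FiniteIntersections.
Variables (K : fieldType) (A : opposite_algebras K).
Local Notation S := (lring A).
Local Notation n := (adim A).

Definition left_ideal (L : S -> Prop) := @is_submodule S S^o L.

Definition of_coords (u : 'rV[K]_n) : S := \sum_i emb A (u 0 i) * basis A i.

Lemma of_coordsD u v : of_coords (u + v) = of_coords u + of_coords v.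
Proof.
by rewrite -big_split /=; apply: eq_bigr => i _; rewrite mxE embD mulrDl.
Qed.

Lemma of_coordsZ k u : of_coords (k *: u) = emb A k * of_coords u.
Proof. by rewrite mulr_sumr; apply: eq_bigr => i _; rewrite mxE embM mulrA. Qed.

Lemma of_coordsK x : exists u, of_coords u = x.
Proof.
exists (\row_i coord A i x); rewrite [RHS](basisE x).
by apply: eq_bigr => i _; rewrite mxE.
Qed.

(** Left ideals become row spaces, whose rank supplies the chain condition. [U] has largest rank
    among the row spaces inside [L], so adjoining a row of [L] cannot enlarge it. *)
Lemma left_ideal_matrix L : left_ideal L ->
  exists U : 'M[K]_n, forall u : 'rV[K]_n, (u <= U)%MS <-> L (of_coords u).
Proof.
move=> [L0 LD LZ].
pose P r := `[< exists U : 'M[K]_n, \rank U = r /\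
  forall u : 'rV[K]_n, (u <= U)%MS -> L (of_coords u) >].
have P0 : exists r, P r.
  exists 0%N; apply/asboolP; exists 0; split=> [|u]; first exact: mxrank0.
  rewrite submx0 => /eqP ->; rewrite /of_coords big1 // => i _.
  by rewrite mxE emb0 mul0r.
have Pn r : P r -> (r <= n)%N by move=> /asboolP[U [<- _]]; exact: rank_leq_row.
have [r /asboolP[U [Ur UL]] rmax] := ex_maxnP P0 Pn.
exists U => u; split=> [|Lu]; first exact: UL.
suff UuU : (U + u <= U)%MS by apply: submx_trans UuU; exact: addsmxSr.
have : \rank (U + u)%MS == \rank U.
  rewrite eqn_leq (mxrankS (addsmxSl U u)) andbT Ur; apply: rmax; apply/asboolP.
  exists (U + u)%MS; split=> // v /sub_addsmxP[[a b] /= ->].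
  rewrite of_coordsD; apply: LD; first by apply: UL; exact: submxMl.
  by rewrite [b]mx11_scalar mul_scalar_mx of_coordsZ; exact: LZ.
by rewrite eq_sym (mxrank_leqif_sup (addsmxSl U u)).
Qed.

Lemma left_ideal_finite_inter (J : eqType) (L : J -> S -> Prop) :
    (forall j, left_ideal (L j)) ->
  exists js : seq J, forall x, (forall j, j \in js -> L j x) -> forall j, L j x.
Proof.
move=> Lideal; pose cap (js : seq J) x := forall j, j \in js -> L j x.
have cap_ideal js : left_ideal (cap js).
  split=> [j|x y Lx Ly j jjs|a x Lx j jjs]; have [L0 LD LZ] := Lideal j => //.
    by apply: LD; [apply: Lx | apply: Ly].
  by apply: LZ; apply: Lx.
pose P r := `[< exists js (U : 'M[K]_n), \rank U = r /\
  forall u : 'rV[K]_n, (u <= U)%MS <-> cap js (of_coords u) >].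
have [|r /asboolP[js [U [Ur UL]]] rmin] := @ex_minnP P.
  have [U UL] := left_ideal_matrix (cap_ideal [::]).
  by exists (\rank U); apply/asboolP; exists [::], U.
exists js => x xjs j; have [V VL] := left_ideal_matrix (cap_ideal (j :: js)).
have VU : (V <= U)%MS.
  apply/row_subP => i; apply/UL => j' j'js.
  by have /VL := row_sub i V; apply; rewrite inE j'js orbT.
have UV : (U <= V)%MS.
  rewrite -(mxrank_leqif_sup VU) eqn_leq mxrankS //= Ur; apply: rmin.
  by apply/asboolP; exists (j :: js), V.
have [u ux] := of_coordsK x; rewrite -ux in xjs *.
by have /VL := submx_trans (iffRL (UL u) xjs) UV; apply; rewrite inE eqxx.
Qed.

End FiniteIntersections.

Definition lann (S : pzRingType) (L : S -> Prop) (x : S) := forall a, L a -> x * a = 0.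
Definition rann (S : pzRingType) (L : S -> Prop) (x : S) := forall a, L a -> a * x = 0.

Section SelfInjective.
Variables (K : fieldType) (A : opposite_algebras K).
Local Notation S := (lring A).
Hypothesis injS : self_injective S.
Implicit Types L I : S -> Prop.

(* The Ikeda-Nakayama identity r(L_1 cap ... cap L_k) = r(L_1) + ... + r(L_k),  *)
(* with the sum replaced by an arbitrary additive subset containing all r(L_j). *)
Lemma rann_inter (J : eqType) (L : J -> S -> Prop) (js : seq J) (Q : S -> Prop) :
    (forall j, left_ideal (L j)) ->
    Q 0 -> (forall x y, Q x -> Q y -> Q (x + y)) ->
    (forall j, j \in js -> forall x, rann (L j) x -> Q x) ->
  forall x, rann (fun a => forall j, j \in js -> L j a) x -> Q x.
Proof.
move=> Lideal Q0 QD; elim: js => [|j js IH] LQ z z_ann.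
  by rewrite -[z]mul1r z_ann.
have [L0 LD LZ] := Lideal j.
pose B a := forall i, i \in js -> L i a.
have [B0 BD BZ] : left_ideal B.
  split=> [i _|x y Lx Ly i ijs|a x Lx i ijs]; have [Li0 LiD LiZ] := Lideal i => //.
    by apply: LiD; [apply: Lx | apply: Ly].
  by apply: LiZ; apply: Lx.
(* Sending [a + a'] to [a * z] is well defined on [L j + B] because [z] kills the intersection.
   Extended to [S] it is right multiplication by [g 1], so [z - g 1] lies in [rann (L j)] and [g 1]
   in [rann B]. *)
have [|||m|g gE] := @injective_graph S S^o S^o
    (fun b m => exists a a', [/\ L j a, B a', b = a + a' & m = a * z]) injS.
- by exists 0, 0; rewrite addr0 mul0r.
- move=> _ _ _ _ [a [a' [La Ba -> ->]]] [b [b' [Lb Bb -> ->]]].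
  exists (a + b), (a' + b'); rewrite addrACA mulrDl.
  by split=> //; [exact: LD | exact: BD].
- move=> c _ _ [a [a' [La Ba -> ->]]]; exists (c * a), (c * a').
  by rewrite scalerDr -mulrA; split=> //; [exact: LZ | exact: BZ].
- move=> [a [a' [La Ba e ->]]]; apply: z_ann => i; rewrite inE => /orP[/eqP ->//|ijs].
  have -> : a = (-1 : S) *: (a' : S^o).
    by rewrite scaleN1r; apply/eqP; rewrite -addr_eq0 -e.
  exact: BZ.
have gmul a : g a = a * g 1 by rewrite -[LHS]/(g a) -{1}[a]mulr1 (linearZ_LR g).
rewrite -(subrK (g 1) z); apply: QD.
  apply: (LQ j); first by rewrite inE eqxx.
  move=> a La; rewrite mulrBr -gmul (gE a (a * z)) ?subrr //.
  by exists a, 0; rewrite addr0.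
apply: IH => [i ijs|a Ba]; first by apply: LQ; rewrite inE ijs orbT.
by rewrite -gmul; apply: gE; exists 0, a; rewrite add0r mul0r.
Qed.

(** The left annihilator of [I] is a finite intersection of annihilators of elements [y] of [I], so
    [rann_inter] reduces the claim to r(l(y)) = yS: if [z] is killed by l(y), sending [a * y] to
    [a * z] extends to a right multiplication. *)
Lemma rann_lann I : I 0 -> (forall x y, I x -> I y -> I (x + y)) ->
  (forall x a, I x -> I (x * a)) -> forall x, rann (lann I) x -> I x.
Proof.
move=> I0 ID IM x x_ann.
pose L y a := I y -> a * y = 0.
have Lideal y : left_ideal (L y).
  split=> [_|a b La Lb Iy|a b Lb Iy]; first by rewrite mul0r.
    by rewrite mulrDl La // Lb // addr0.
  by rewrite -mulrA Lb // mulr0.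
have [js jsP] := left_ideal_finite_inter Lideal.
apply: (rann_inter Lideal I0 ID (js := js)) => [y _ z zL|a /jsP aL].
  have [Iy|nIy] := pselect (I y); last by rewrite -[z]mul1r zL.
  have [||||g gE] := @injective_graph S S^o S^o
      (fun b m => exists2 a, b = a * y & m = a * z) injS.
  - by exists 0; rewrite mul0r.
  - by move=> _ _ _ _ [a -> ->] [b -> ->]; exists (a + b); rewrite mulrDl.
  - by move=> c _ _ [a -> ->]; exists (c * a); rewrite -mulrA.
  - by move=> m [a e ->]; apply: zL => _; rewrite -e.
  have <- : y * g 1 = z.
    rewrite -[LHS](linearZ_LR g); apply: gE; exists 1; rewrite mul1r //.
    exact: mulr1.
  exact: IM.
by apply: x_ann => y Iy; apply: aL.
Qed.

Definition two_sided I := left_ideal I /\ forall x a, I x -> I (x * a).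

Lemma lann_two_sided I : two_sided I -> two_sided (lann I).
Proof.
move=> [[I0 ID IZ] IM]; split; last by move=> x a xI b Ib; rewrite -mulrA; apply/xI/IZ.
split=> [a _|x y xI yI a Ia|c x xI a Ia]; first by rewrite mul0r.
  by rewrite mulrDl xI // yI // addr0.
by rewrite -mulrA xI // mulr0.
Qed.

(* The maps [p |-> ll p] and [p |-> rr p] satisfy [rr (ll p) = p], and [rr]     *)
(* commutes with finite intersections. If [rann p = 0], i.e. [rr p = S], the    *)
(* descending chain of the intersections of [p, ll p, llll p, ...] becomes      *)
(* stationary, and applying [rr] moves the stationarity down to [S <= p].       *)
Lemma rann_two_sided_neq0 p : two_sided p -> ~ p 1 -> exists2 y, y <> 0 & rann p y.
Proof.
move=> p_ideal p1; apply: contrapT => Ny; apply: p1.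
have rann0 y : rann p y -> y = 0 by move=> py; apply: contrapT => y0; apply: Ny; exists y.
pose q k := iter k (fun I => lann (lann I)) p.
have q_ideal k : two_sided (q k) by elim: k => //= k IH; do 2!apply: lann_two_sided.
have rrq k x : rann (rann (q k.+1)) x <-> q k x.
  have [[q0 qD qZ] qM] := q_ideal k; split=> [x_ann|qx a a_ann].
    apply: (rann_lann q0 qD qM) => a aq; apply: x_ann => b bq; exact: bq.
  have [[l0 lD lZ] lM] := lann_two_sided (q_ideal k).
  by apply: (rann_lann l0 lD lM) qx.
have rr0 x : rann (rann (q 0%N)) x by move=> a /rann0 ->; rewrite mul0r.
have [js jsP] := left_ideal_finite_inter (fun k => (q_ideal k).1).
pose k0 := (\max_(j <- js) j)%N.
have stat : forall x, (forall i, (i <= k0)%N -> q i x) -> q k0.+1 x.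
  by move=> x xq; apply: jsP => j jjs; apply: xq; apply: leq_bigmax_seq.
elim: k0 stat => [|k IH] stat.
  have /rrq // : rann (rann (q 1%N)) 1.
  move=> a aq; apply: rr0 => b bq; apply: aq; apply: stat => i.
  by rewrite leqn0 => /eqP ->.
apply: IH => x xq; apply/rrq => a aq.
(* By stationarity at [k.+1], [a] is a right annihilator of the intersection of [q 0], ...,
   [q k.+1]. It thus suffices that [x] is killed by [rann (q 0)], which is zero, and by each
   [rann (q i.+1)], which holds because [x] is in [q i]. *)
apply: (@rann_inter _ q (iota 0 k.+2) (fun z => z * x = 0) (fun k => (q_ideal k).1)).
- by rewrite mul0r.
- by move=> y z yx zx; rewrite mulrDl yx zx addr0.
- move=> [_ y|i]; first exact: rr0.
  rewrite mem_iota add0n !ltnS => /= ik y; exact: (iffRL (rrq i x) (xq i ik)).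
move=> b bq; apply: aq; apply: stat => i ik; apply: bq.
by rewrite mem_iota add0n ltnS.
Qed.

Lemma rann_left_ideal_neq0 L : left_ideal L -> ~ L 1 ->
  exists2 y, y <> 0 & rann L y.
Proof.
move=> Lideal L1; have [L0 LD LZ] := Lideal.
(* The largest two-sided ideal inside [L]. It is the intersection of the [M i] below, the
   annihilators of the classes of the [basis A i] in S/L. *)
pose p a := forall s, L (a * s).
have p_ideal : two_sided p.
  split; last by move=> x a px s; rewrite -mulrA.
  split=> [s|x y px py s|a x px s]; first by rewrite mul0r.
    by rewrite mulrDl; apply: LD.
  by rewrite -mulrA; apply: LZ.
have [|y y0 py] := rann_two_sided_neq0 p_ideal.
  by move=> /(_ 1); rewrite mulr1.
pose M i a := L (a * basis A i).
have Mideal i : left_ideal (M i).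
  rewrite /M; split=> [|a b|a b]; first by rewrite mul0r.
    by rewrite mulrDl; apply: LD.
  by rewrite -mulrA; apply: LZ.
have [i [z z0 zM]] : exists i, exists2 z, z <> 0 & rann (M i) z.
  apply: contrapT => NM; apply: y0.
  apply: (@rann_inter _ M (enum 'I_(adim A)) (fun z => z = 0) Mideal) => //.
  - by move=> _ _ -> ->; rewrite addr0.
  - by move=> i _ x xM; apply: contrapT => x0; apply: NM; exists i, x.
  move=> a aM; apply: py => s; rewrite (basisE s) mulr_sumr.
  apply: (big_ind L) => // i _; rewrite mulrA -embC -mulrA.
  by apply: LZ; apply: aM; rewrite mem_enum.
(* [z] defines a map to [S] on the submodule of S/L generated by the class of [basis A i]; [g] is
   its extension to S/L, seen as a map on [S] killing [L]. *)
have [|||m|g gE] := @injective_graph S S^o S^o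
    (fun b m => exists2 a, L (b - a * basis A i) & m = a * z) injS.
- by exists 0; rewrite mul0r ?subr0.
- move=> b _ b' _ [a La ->] [a' La' ->]; exists (a + a'); last by rewrite mulrDl.
  by rewrite mulrDl opprD addrACA; apply: LD.
- move=> c b _ [a La ->]; exists (c * a); last by rewrite -mulrA.
  by rewrite -mulrA -[X in L X](mulrBr c b); apply: LZ.
- move=> [a La ->]; apply: zM; rewrite /M.
  by have := LZ (-1) _ La; rewrite scaleN1r opprB subr0.
have gmul a : g a = a * g 1 by rewrite -[LHS]/(g a) -{1}[a]mulr1 (linearZ_LR g).
exists (g 1).
  move=> g1; apply: z0.
  have <- : g (basis A i) = z by apply: gE; exists 1; rewrite mul1r ?subrr.
  by rewrite gmul g1 mulr0.
by move=> a La; rewrite -gmul; apply: gE; exists 0; rewrite mul0r ?subr0.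
Qed.

(** The submodule generated by [x] is S/L with [L] the annihilator of [x]; a nonzero element of
    [rann L] gives a map from it to [S] that is nonzero at [x], and injectivity extends the map to
    [M]. *)
Lemma self_injective_separates (M : lmodType S) (x : M) : x <> 0 ->
  exists f : {linear M -> S^o}, f x <> 0.
Proof.
move=> x0; pose L (a : S) := a *: x = 0.
have Lideal : left_ideal L.
  split=> [|a b La Lb|a b Lb]; first exact: scale0r.
    by rewrite /L scalerDl La Lb addr0.
  by rewrite /L -scalerA Lb scaler0.
have [|y y0 Ly] := rann_left_ideal_neq0 Lideal; first by rewrite /L scale1r.
have [||||g gE] := @injective_graph S S^o M
    (fun b m => exists2 a, b = a *: x & m = a * y) injS.
- by exists 0; rewrite ?scale0r ?mul0r.
- by move=> _ _ _ _ [a -> ->] [b -> ->]; exists (a + b); rewrite ?scalerDl ?mulrDl.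
- by move=> c _ _ [a -> ->]; exists (c * a); rewrite -?scalerA -?mulrA.
- by move=> m [a e ->]; apply: Ly.
by exists g; rewrite (gE x y) //; exists 1; rewrite ?scale1r ?mul1r.
Qed.

Lemma projective_injective (P : lmodType S) :
  projective_module P -> injective_module P.
Proof.
move=> /(@projective_sub_power _ A)[X [i [r iK]]].
exact: injective_retract iK (injective_power injS).
Qed.

Lemma injective_projective (E : lmodType S) :
  injective_module E -> projective_module E.
Proof.
move=> injE.
have lin_ev : linear (fun (x : E) (f : {linear E -> S^o}) => f x).
  by move=> a x y; apply: funext => f; rewrite linearP.
have ev_inj : injective (lin_of lin_ev).
  move=> x y e; apply/eqP; rewrite -subr_eq0; apply/eqP; apply: contrapT.
  move=> /self_injective_separates[f]; rewrite linearB /=.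
  by rewrite (congr1 (fun u => u f) e : f x = f y) subrr.
have [r rK] := injective_split injE ev_inj.
exact: (projective_retract rK (@projective_power _ A _)).
Qed.

End SelfInjective.

Lemma projective_ring (S : pzRingType) : projective_module S^o.
Proof.
move=> M N g f g_surj; have [x xE] := g_surj (f 1).
have lin_h : linear (fun a : S^o => a *: x).
  by move=> a b c; rewrite scalerDl scalerA.
exists (lin_of lin_h) => a /=.
by rewrite linearZ /= xE -[in RHS](mulr1 a) (linearZ_LR f).
Qed.

Lemma self_injective_swap (K : fieldType) (A : opposite_algebras K) :
  self_injective (lring A) -> self_injective (rring A).
Proof.
move=> injS; have [e [c ec]] := ring_dual_basis (swap A).
have [i [r [iK _]]] := bidual ec.
apply: (injective_retract iK); apply: dual_injective.
apply: injective_projective => //.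
exact: (@dual_injective K (swap A) _ (@projective_ring (rring A))).
Qed.

(** * Bounded acyclic complexes *)

Section BoundedComplexes.
Variable S : pzRingType.

Definition zero_mod : lmodType S := void -> S^o.

Lemma zero_mod_eq (x y : zero_mod) : x = y. Proof. by apply: funext. Qed.

Lemma projective_zero : projective_module zero_mod.
Proof.
move=> M N g f _; exists \0 => x.
by rewrite (zero_mod_eq x 0) !linear0.
Qed.

Lemma injective_zero : injective_module zero_mod.
Proof. by move=> M N g f _; exists \0 => x; exact: zero_mod_eq. Qed.

Variable M : nat -> lmodType S.

Section Below.
Variable d : forall n, {linear M n -> M n.+1}.
Hypotheses (d0_inj : injective (d 0%N))
  (d_exact : forall n y, d n.+1 y = 0 <-> exists x, d n x = y).

Definition below_obj (i : int) : lmodType S := if i is Posz n then M n else zero_mod.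

(** The cast is needed because [Posz n + 1] computes to [Posz (n + 1)] and not to [Posz n.+1]. *)
Definition below_map n m (e : n.+1 = m) : {linear M n -> M m} :=
  ecast k {linear M n -> M k} e (d n).

Lemma below_map_exact n m k (e : n.+1 = m) (e' : m.+1 = k) y :
  below_map e' y = 0 <-> exists x, below_map e x = y.
Proof. by case: m / e e' y => e'; case: k / e' => y; exact: d_exact. Qed.

Definition below_diff i : {linear below_obj i -> below_obj (i + 1)} :=
  match i with
  | Posz n => below_map (esym (addn1 n))
  | Negz n => \0
  end.

Lemma below_diffK i x : below_diff (i + 1) (below_diff i x) = 0.
Proof.
case: i x => n x; last exact: linear0.
by apply: (iffRL (@below_map_exact _ _ _ (esym (addn1 n)) _ _)); exists x.
Qed.

Definition below_complex : complex S := Complex below_diffK.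

Lemma below_acyclic : acyclic below_complex.
Proof.
case=> [n|[|n]] /= y.
- exact: (iffLR (@below_map_exact _ _ _ _ _ y)).
- move: y (esym _); rewrite /= => y e dy; exists 0.
  have : d 0%N y = 0 by move: dy; rewrite /below_map (eq_axiomK e).
  by rewrite -(linear0 (d 0%N)) => /d0_inj.
- by move=> _; exists 0; exact: zero_mod_eq.
Qed.

Lemma below_projective : (forall n, projective_module (M n)) ->
  forall i, projective_module (below_complex i).
Proof. by move=> projM [n|n] //=; exact: projective_zero. Qed.

Lemma below_exact_Hom_to N : exact_Hom_to below_complex N ->
  forall f : {linear M 0%N -> N}, exists g : {linear M 1%N -> N},
    forall x, g (d 0%N x) = f x.
Proof.
(* Exactness in degree 0: the object in degree -1 is zero, so every [f] is a cocycle. *)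
move=> exN f; have [|g gE] := exN (Negz 0) f; first by move=> x; exact: linear0.
exists g => x; rewrite -gE /=; congr (g _).
by rewrite /below_map; move: (esym _) => e; rewrite (eq_axiomK e).
Qed.

End Below.

Section Above.
Variable d : forall n, {linear M n.+1 -> M n}.
Hypotheses (d0_surj : forall y, exists x, d 0%N x = y)
  (d_exact : forall n y, d n y = 0 <-> exists x, d n.+1 x = y).

(** [Negz n] is the degree -(n+1), so [M 0] sits in degree -1. *)
Definition above_obj (i : int) : lmodType S := if i is Negz n then M n else zero_mod.

Definition above_map n m (e : n = m) : {linear M n.+1 -> M m} :=
  ecast k {linear M n.+1 -> M k} e (d n).

Lemma above_map_exact n k (e : n.+1 = n.+1) (e' : n = k) y :
  above_map e' y = 0 <-> exists x, above_map e x = y.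
Proof. by case: k / e'; rewrite /above_map (eq_axiomK e); exact: d_exact. Qed.

Definition above_diff i : {linear above_obj i -> above_obj (i + 1)} :=
  match i with
  | Negz n.+1 => above_map (esym (subn1 n.+1))
  | Negz 0 => \0
  | Posz n => \0
  end.

Lemma above_diffK i x : above_diff (i + 1) (above_diff i x) = 0.
Proof.
case: i x => [n|[|[|n]]] x; try exact: zero_mod_eq; try exact: linear0.
by apply: (iffRL (@above_map_exact _ _ (esym (subn1 n.+2)) _ _)); exists x.
Qed.

Definition above_complex : complex S := Complex above_diffK.

Lemma above_acyclic : acyclic above_complex.
Proof.
case=> [n|[|[|n]]] y /=.
- by move=> _; exists 0; exact: zero_mod_eq.
- by move=> _; exists 0; exact: zero_mod_eq.
- by move=> _; rewrite /above_map (eq_axiomK (esym _)); exact: d0_surj.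
- exact: (iffLR (@above_map_exact _ _ _ _ y)).
Qed.

Lemma above_injective : (forall n, injective_module (M n)) ->
  forall i, injective_module (above_complex i).
Proof. by move=> injM [n|n] //=; exact: injective_zero. Qed.

Lemma above_exact_Hom_from N : exact_Hom_from N above_complex ->
  forall f : {linear N -> M 0%N}, exists g : {linear N -> M 1%N},
    forall x, d 0%N (g x) = f x.
Proof.
move=> exN f; have [|g gE] := exN (Negz 1) f; first by move=> x.
by exists g => x; rewrite -gE /= /above_map (eq_axiomK (esym _)).
Qed.

End Above.

End BoundedComplexes.

(** * Dual coresolutions, and self-injectivity from total acyclicity *)

Section DualCoresolution.
Variables (K : fieldType) (A : opposite_algebras K).
Local Notation S := (lring A).
Variables (E : nat -> lmodType S) (eta : {linear S^o -> E 0%N})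
  (d : forall i, {linear E i -> E i.+1}).
Hypotheses (eta_inj : injective eta)
  (d0_exact : forall y, d 0%N y = 0 <-> exists x, eta x = y)
  (d_exact : forall i y, d i.+1 y = 0 <-> exists x, d i x = y)
  (projE : forall i, projective_module (E i)).

Definition dual_cores_obj n : lmodType (rring A) :=
  if n is m.+1 then dual (E m) else dual S^o.

Definition dual_cores_map n : {linear dual_cores_obj n.+1 -> dual_cores_obj n} :=
  match n with 0 => dual_map eta | m.+1 => dual_map (d m) end.

Lemma dual_exact (U V W : lmodType S) (a : {linear U -> V}) (b : {linear V -> W}) :
    (forall y, b y = 0 <-> exists x, a x = y) ->
  forall f : dual V, dual_map a f = 0 <-> exists g, dual_map b g = f.
Proof.
move=> ab f; split=> [f0|[g <-]]; last first.
  apply: dualP => x; rewrite !dual_mapE (_ : b (a x) = 0) ?dual0 //.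
  by apply/ab; exists x.
have [x /ab[u <-]|g gE] := dual_extend (d := b) (f := f).
  by rewrite -(dual_mapE a) f0.
by exists g; apply: dualP.
Qed.

Lemma dual_cores_exact n y :
  dual_cores_map n y = 0 <-> exists x, dual_cores_map n.+1 x = y.
Proof. by case: n y => [|n] y; apply: dual_exact. Qed.

Lemma dual_cores_surj y : exists x, dual_cores_map 0%N x = y.
Proof.
have [x|g gE] := dual_extend (d := eta) (f := y).
  by rewrite -(linear0 eta) => /eta_inj ->; rewrite dual0.
by exists g; apply: dualP.
Qed.

Lemma dual_cores_injective n : injective_module (dual_cores_obj n).
Proof. by case: n => [|n]; apply: dual_injective; first exact: projective_ring. Qed.

End DualCoresolution.

Definition projective_injective_coresolution (S : pzRingType) : Prop :=
  exists (E : nat -> lmodType S) (eta : {linear S^o -> E 0%N})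
         (d : forall i, {linear E i -> E i.+1}),
    [/\ injective eta,
        forall y, d 0%N y = 0 <-> exists x, eta x = y,
        forall i y, d i.+1 y = 0 <-> exists x, d i x = y &
        forall i, projective_module (E i) /\ injective_module (E i)].

Lemma self_injective_of_projectives (S : pzRingType) :
  projective_injective_coresolution S ->
  all_acyclic_projectives_totally_acyclic S -> self_injective S.
Proof.
move=> [E [eta [d [eta_inj d0_exact d_exact E_pi]]]] tot.
pose M n : lmodType S := if n is m.+1 then E m else S^o.
pose dM n : {linear M n -> M n.+1} :=
  match n with 0 => eta | m.+1 => d m end.
have dM_exact n y : dM n.+1 y = 0 <-> exists x, dM n x = y by case: n y.
have projM n : projective_module (M n).
  by case: n => [|n]; [exact: projective_ring | have [] := E_pi n].
have [|_ tot_hom] := tot (below_complex dM_exact).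
  by split; [exact: below_acyclic | exact: below_projective].
have [r rE] := below_exact_Hom_to (tot_hom _ (@projective_ring S)) idfun.
exact: injective_retract rE (E_pi 0%N).2.
Qed.

Lemma self_injective_of_opposite_injectives (K : fieldType) (A : opposite_algebras K) :
  projective_injective_coresolution (lring A) ->
  all_acyclic_injectives_totally_acyclic (rring A) -> self_injective (lring A).
Proof.
move=> [E [eta [d [eta_inj d0_exact d_exact E_pi]]]] tot.
have projE i : projective_module (E i) by have [] := E_pi i.
have cores_exact := dual_cores_exact d0_exact d_exact.
have injM := dual_cores_injective projE.
have [|_ tot_hom] := tot (above_complex cores_exact).
  by split; [apply: above_acyclic; exact: dual_cores_surj | exact: above_injective].
have [g gE] := above_exact_Hom_from (tot_hom _ (injM 0%N)) idfun.
have [e [c ec]] := ring_dual_basis A.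
(* [g] is a section of the dual of [eta]. As the ring is reflexive, sending [f] to the value of
   [g f] at [x] is evaluation at some [r x]; this [r] is the retraction of [eta] dual to [g]. *)
have /choice[r rE] x : exists a : (lring A)^o, forall f : dual (lring A)^o,
    (g f : dual (E 0%N)) x = f a.
  apply: (dual_reflexive ec) => [f f'|k f f' ff']; first by rewrite linearD.
  rewrite -[RHS](dualZ (g f : dual (E 0%N))) -[emb A k]ltorK -scale_dualE -linearZ.
  congr (dual_fun (g _) x).
  by apply: dualP => y; rewrite ff' scale_dualE ltorK dualZ.
have lin_r : linear r.
  move=> a x y; apply: (@dual_eq _ A) => f.
  by rewrite -rE !dualD -!rE -[a]ltorK -!scale_dualE -rE linearZ.
apply: (injective_retract (i := eta) (r := lin_of lin_r)) (E_pi 0%N).2.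
move=> a; apply: (@dual_eq _ A) => f.
by rewrite -[LHS]rE -(dual_mapE eta) gE.
Qed.

(** * Left-right symmetry of infinite dominant dimension *)

Section Tower.
Variables (T : pzRingType) (Q : lmodType T).

Record arrow := Arrow {
  asrc : lmodType T; atgt : lmodType T; amap : {linear asrc -> atgt} }.

Definition annihilating (a : arrow) : Type :=
  {h : {linear atgt a -> Q} | forall x, h (amap a x) = 0}.

Definition next_map_fun a (y : atgt a) : annihilating a -> Q := fun h => sval h y.

Lemma next_map_linear a : linear (@next_map_fun a).
Proof. by move=> c x y; apply: funext => h; rewrite /next_map_fun linearP. Qed.

(* A left approximation of the cokernel of [amap a] by powers of [Q]. *)
Definition next a : arrow := Arrow (lin_of (@next_map_linear a)).

(** The objects are 0, [T], and then powers of [Q]; because of the initial 0, exactness at [T] is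
    injectivity of the coaugmentation. *)
Definition tower n : arrow :=
  iter n next (Arrow (\0 : {linear zero_mod T -> T^o})).

Definition tower_obj n : lmodType T := asrc (tower n).

Definition tower_map n : {linear tower_obj n -> tower_obj n.+1} := amap (tower n).

Lemma tower_mapK n x : tower_map n.+1 (tower_map n x) = 0.
Proof. by apply: funext => -[h h0]; exact: h0. Qed.

(** Each coordinate of [i \o h] is one of the maps indexing the power of [Q], so the factorization
    merely selects coordinates. *)
Lemma tower_factor n Y (N : lmodType T)
    (i : {linear N -> (Y -> Q)}) (r : {linear (Y -> Q) -> N})
    (h : {linear tower_obj n.+1 -> N}) : cancel i r ->
    (forall x, h (tower_map n x) = 0) ->
  exists v : {linear tower_obj n.+2 -> N}, forall x, v (tower_map n.+1 x) = h x.
Proof.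
move=> iK h0.
have lin_ih y : linear (fun x => i (h x) y) by move=> a x x'; rewrite !linearP.
have ih0 y x : lin_of (lin_ih y) (amap (tower n) x) = 0.
  by rewrite /= [h _]h0 linear0.
pose hy y : annihilating (tower n) := exist _ (lin_of (lin_ih y)) (ih0 y).
have lin_v : linear (fun u : annihilating (tower n) -> Q => (fun y => u (hy y))).
  by move=> a u u'; apply: funext.
by exists (r \o lin_of lin_v : {linear tower_obj n.+2 -> N}) => x; exact: iK.
Qed.

End Tower.

Section Symmetry.
Variables (K : fieldType) (A : opposite_algebras K).
Local Notation S := (lring A).
Local Notation T := (rring A).
Variables (E : nat -> lmodType S) (eta : {linear S^o -> E 0%N})
  (d : forall i, {linear E i -> E i.+1}).
Hypotheses (min_cores : minimal_injective_coresolution eta d)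
  (projE : forall i, projective_module (E i)).
Local Notation Q := (dual (E 0%N) : lmodType T).
Local Notation F := (@tower_obj T Q).
Local Notation f := (@tower_map T Q).
Local Notation N := (dual_cores_obj E).
Local Notation pi := (dual_cores_map eta d).

(** This makes all powers of [Q] projective. The ring embeds in the injective module D(T^n); the
    embedding extends to [E 0], stays injective because [E 0] is an essential extension of the ring,
    and splits. Dualizing gives the retract. *)
Lemma envelope_dual_retract :
  exists (i : {linear Q -> ('I_(adim A) -> T^o)}) (r : {linear ('I_(adim A) -> T^o) -> Q}),
    cancel i r.
Proof.
have [eta_inj d0_exact _ injE ess] := min_cores.
pose V := 'I_(adim A) -> T^o.
pose phi (a : S) (u : V) : K := \sum_i coord A i (rtol (u i) * a).
have phiD a u v : phi a (u + v) = phi a u + phi a v.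
  rewrite /phi -big_split; apply: eq_bigr => i _ /=.
  by rewrite fctE rtolD mulrDl coordD.
have phiZ a k u : phi a (ltor A (emb A k) *: u) = k * phi a u.
  rewrite /phi mulr_sumr; apply: eq_bigr => i _.
  rewrite -coordZ; congr coord.
  by rewrite scalrfctE [rtol _]rtolM ltorK -embC -mulrA.
pose j0 a : @dual K (swap A) V := @Dual K (swap A) V (phi a) (phiD a) (phiZ a).
have lin_j0 : linear (j0 : S^o -> codual V).
  move=> c a b; apply: dualP => u; rewrite add_dualE scale_dualE !DualE.
  rewrite /phi -big_split; apply: eq_bigr => i _ /=.
  rewrite mulrDr coordD; congr (_ + _); congr coord.
  rewrite mulrA; congr (_ * _).
  exact: esym (etrans (rtolM _ _) (congr1 ( *%R (rtol (u i))) (ltorK c))).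
have j0_inj a : j0 a = 0 -> a = 0.
  move=> j0a; rewrite (basisE a) big1 // => i _.
  have := congr1 (fun g : @dual K (swap A) V => g (fun k => (k == i)%:R : T^o)) j0a.
  have rtol0 : rtol (0 : T) = 0 :> S by exact: (ltor0 (swap A)).
  rewrite DualE zero_dualE /phi (bigD1 i) //= eqxx rtol1 mul1r big1 => [|k /negPf ki].
    by rewrite addr0 => ->; rewrite emb0 mul0r.
  by rewrite ki rtol0 mul0r coord0.
have injV : injective_module (codual V).
  by apply: (@dual_injective K (swap A)); exact: (@projective_power K (swap A)).
have [j jE] := injV _ _ eta (lin_of lin_j0) eta_inj.
have j_inj : injective j.
  suff j0' x : j x = 0 -> x = 0.
    by move=> x y /eqP; rewrite -subr_eq0 -linearB => /eqP/j0'/eqP;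
      rewrite subr_eq0 => /eqP.
  move=> jx; apply: contrapT => x0.
  have [||y [jy dy y0]] := (ess 0%N).2 (fun x => j x = 0).
  - split=> [|y z jy jz|a y jy]; first exact: linear0.
      by rewrite linearD jy jz addr0.
    by rewrite linearZ /= jy scaler0.
  - by exists x.
  apply: y0; move/d0_exact: dy jy => [a <-]; rewrite jE => /j0_inj ->.
  exact: linear0.
have [r rK] := injective_split (injE 0%N) j_inj.
have [e [c ec]] := power_dual_basis (swap A) (adim A).
have [i [i' [_ i'K]]] := bidual ec.
exists (i' \o dual_map r : {linear Q -> V}), (dual_map j \o i : {linear V -> Q}).
move=> g; rewrite /= i'K; apply: dualP => x.
by rewrite !dual_mapE rK.
Qed.

Lemma tower_projective_injective n :
  projective_module (F n.+2) /\ injective_module (F n.+2).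
Proof.
have [i [r iK]] := envelope_dual_retract.
split; first exact: (@projective_power_retract K (swap A) (annihilating Q (tower Q n)) _ Q i r iK).
exact: (@injective_power T (annihilating Q (tower Q n)) Q (dual_injective (@projE 0%N))).
Qed.

Lemma tower_projective n : projective_module (F n).
Proof.
case: n => [|[|n]]; [exact: projective_zero | exact: projective_ring |].
by have [] := tower_projective_injective n.
Qed.

(* Since [E 0] contains the ring and [E i] is injective, [E 0] generates [E i]. *)
Lemma dual_cores_retract i :
  exists Y (j : {linear N i.+1 -> (Y -> Q)}) (r : {linear (Y -> Q) -> N i.+1}),
    cancel j r.
Proof.
have [eta_inj _ _ injE _] := min_cores.
have lin_j : linear (fun (g : N i.+1) (h : {linear E 0%N -> E i}) => dual_map h g : Q).
  by move=> a g g'; apply: funext => h; rewrite linearP.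
have j_inj : injective (lin_of lin_j).
  move=> g g' gg'; apply: dualP => x.
  have lin_x : linear ((fun a : S => a *: (x : E i)) : S^o -> E i).
    by move=> a b c; rewrite scalerDl scalerA.
  have [h hE] := injE i _ _ eta (lin_of lin_x) eta_inj.
  have hx : h (eta 1) = x by rewrite hE /= scale1r.
  rewrite -hx -!(dual_mapE h).
  by rewrite (congr1 (fun u => u h) gg' : dual_map h g = dual_map h g').
have [r rK] := injective_split (dual_injective (@projE i)) j_inj.
by exists {linear E 0%N -> E i}, (lin_of lin_j), r.
Qed.

(* Dimension shifting along the exact sequence [N]: the step from [i.+1] to [i] *)
(* works because [F n] is projective and [N i.+1] is a retract of a power.     *)
Lemma tower_image_factor n i (h : {linear F n.+1 -> N i}) :
    (forall x, h (f n x) = 0) -> (forall x, exists y, pi i y = h x) ->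
  exists v : {linear F n.+2 -> N i},
    (forall x, exists y, pi i y = v x) /\ (forall x, v (f n.+1 x) = h x).
Proof.
have [_ d0_exact d_exact _ _] := min_cores.
have pi_exact := dual_cores_exact d0_exact d_exact.
elim: n i h => [|n IH] i h h0 h_im.
all: have [h' h'E] := projective_factor (@tower_projective _) h_im.
all: have [Y [j [r jK]]] := dual_cores_retract i.
  have [|v vE] := tower_factor (h := h') jK.
    by move=> x; rewrite (zero_mod_eq x 0) !linear0.
  exists (pi i \o v : {linear F 2 -> N i}); split=> x; first by exists (v x).
  by rewrite /= vE h'E.
have [|x|u [u_im uE]] := IH i.+1 (h' \o f n.+1 : {linear F n.+1 -> N i.+1}).
- by move=> x; rewrite -[LHS]/(h' (f n.+1 (f n x))) tower_mapK linear0.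
- by apply/pi_exact; rewrite /= h'E h0.
(* [pi i] kills the image of [u], so [h' - u] still lifts [h]; unlike [h'] it vanishes on the image
   of [f n.+1]. *)
have lin_hu : linear (fun x => h' x - u x).
  by move=> a x y; rewrite (linearP h') (linearP u) scalerBr opprD addrACA.
have [|v vE] := tower_factor (h := lin_of lin_hu) jK.
  by move=> x; rewrite /= uE subrr.
exists (pi i \o v : {linear F n.+3 -> N i}); split=> x; first by exists (v x).
by rewrite /= vE linearB /= h'E (iffRL (pi_exact _ _) (u_im x)) subr0.
Qed.

(** A functional [l] on [F n.+1] is the same as a [T]-linear map [h] into D(S), with [l] recovered
    by evaluation at 1. If [l] kills the image of [f n], so does [h], which then factors through
    [f n.+1]; hence [l] vanishes on the kernel of [f n.+1] and cannot separate it from that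
    image. *)
Lemma tower_exact n y : f n.+1 y = 0 <-> exists x, f n x = y.
Proof.
have [eta_inj d0_exact d_exact _ _] := min_cores.
split=> [fy|[x <-]]; last exact: tower_mapK.
apply: contrapT => /(@dual_separates K (swap A) _ _ (f n))[l lf /eqP]; apply.
have lin_l : linear ((fun s : S => s *: (l : codual (F n.+1))) : S^o -> codual (F n.+1)).
  by move=> a s s'; rewrite scalerDl scalerA.
have [h hE] := flip_out (lin_of lin_l).
have [x|x|v [_ vE]] := @tower_image_factor n 0%N (h : {linear F n.+1 -> N 0%N}).
- apply: dualP => s; rewrite hE /= scale_dualE -linearZ; exact: lf.
- exact: dual_cores_surj.
have := hE 1 y; rewrite -vE fy linear0 zero_dualE.
by rewrite /= scale1r.
Qed.

End Symmetry.

Lemma opposite_coresolution (K : fieldType) (A : opposite_algebras K) :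
  infinite_dominant_dimension (lring A) ->
  projective_injective_coresolution (rring A).
Proof.
move=> [E [eta [d [min_cores projE]]]].
pose Q : lmodType (rring A) := dual (E 0%N).
exists (fun n => tower_obj Q n.+2), (tower_map Q 1), (fun n => tower_map Q n.+2).
have exact_tower := tower_exact min_cores projE.
split=> [x y|||].
- move=> /eqP; rewrite -subr_eq0 -linearB => /eqP/exact_tower[z].
  rewrite (zero_mod_eq z 0) linear0 => /esym/eqP.
  by rewrite subr_eq0 => /eqP.
- by move=> y; exact: exact_tower.
- by move=> i y; exact: exact_tower.
- exact: tower_projective_injective min_cores projE.
Qed.

Lemma minimal_coresolution (S : pzRingType) :
  infinite_dominant_dimension S -> projective_injective_coresolution S.
Proof.
move=> [E [eta [d [[eta_inj d0_exact d_exact injE _] projE]]]].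
by exists E, eta, d.
Qed.

(** * Finite-dimensional algebras and the equivalences *)

Section FiniteDimensionalAlgebra.
Variables (K : fieldType) (R : falgType K).

Definition falg_opposite : opposite_algebras K.
Proof.
pose b := vbasis {:R}.
refine (@OppositeAlgebras K R R^c (fun x => x) (fun x => x) (fun=> erefl)
  (fun=> erefl) (fun _ _ => erefl) erefl (fun _ _ => erefl)
  (fun k => k%:A) _ _ _ _ (\dim {:R}) (tnth b) (fun i => vector.coord b i) _ _ _).
- by move=> k l; rewrite scalerDl.
- by rewrite scale1r.
- by move=> k l; rewrite mulr_algl scalerA.
- by move=> k x; rewrite mulr_algl mulr_algr.
- by move=> i x y; rewrite linearD.
- by move=> i k x; rewrite mulr_algl linearZ.
- move=> x; rewrite {1}(coord_vbasis (memvf x)); apply: eq_bigr => i _.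
  by rewrite mulr_algl (tnth_nth 0).
Defined.

End FiniteDimensionalAlgebra.

Lemma self_injective_totally_acyclic (K : fieldType) (A : opposite_algebras K) :
  self_injective (lring A) ->
  all_acyclic_injectives_totally_acyclic (lring A) /\
  all_acyclic_projectives_totally_acyclic (lring A).
Proof.
move=> injS; split=> X [X_acyclic X_obj]; split=> // M M_obj i f f0.
  have projM := injective_projective injS M_obj.
  by apply: (projective_factor projM) => x; apply: X_acyclic.
have injM := projective_injective injS M_obj.
apply: (injective_factor injM) => x dx.
by have [y <-] := X_acyclic _ _ dx.
Qed.

Theorem corollary2p11 (K : fieldType) (R : falgType K)
    (domdimR : infinite_dominant_dimension R) :
  [<-> (* (i) *) self_injective R;
       (* (ii) *) all_acyclic_injectives_totally_acyclic R
                  /\ all_acyclic_injectives_totally_acyclic R^c;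
       (* (iii) *) all_acyclic_projectives_totally_acyclic R
                   /\ all_acyclic_projectives_totally_acyclic R^c;
       (* (iv) *) all_acyclic_injectives_totally_acyclic R;
       (* (v) *) all_acyclic_projectives_totally_acyclic R;
       (* (vi) *) all_acyclic_injectives_totally_acyclic R^c;
       (* (vii) *) all_acyclic_projectives_totally_acyclic R^c].
Proof.
pose A := falg_opposite R.
have coresR : projective_injective_coresolution R := minimal_coresolution domdimR.
have coresRc : projective_injective_coresolution R^c :=
  @opposite_coresolution K A domdimR.
have swapR : self_injective R^c -> self_injective R := @self_injective_swap K (swap A).
have all_true : self_injective R ->
  [/\ all_acyclic_injectives_totally_acyclic R,
      all_acyclic_injectives_totally_acyclic R^c,
      all_acyclic_projectives_totally_acyclic R &
      all_acyclic_projectives_totally_acyclic R^c].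
  move=> injR; have [iR pR] := @self_injective_totally_acyclic K A injR.
  have [iRc pRc] := @self_injective_totally_acyclic K (swap A) (@self_injective_swap K A injR).
  by split.
(* The dual of a coresolution of [R^c] consists of injectives over [R], so the hypothesis first
   makes [R^c] self-injective. *)
have from_iR : all_acyclic_injectives_totally_acyclic R -> self_injective R.
  by move=> tot; apply/swapR/(@self_injective_of_opposite_injectives K (swap A) coresRc tot).
have from_pR := self_injective_of_projectives coresR.
have from_iRc : all_acyclic_injectives_totally_acyclic R^c -> self_injective R :=
  @self_injective_of_opposite_injectives K A coresR.
have from_pRc tot : self_injective R := swapR (self_injective_of_projectives coresRc tot).
tfae.
- by move=> /all_true[].
- by move=> [/from_iR/all_true[]].
- by move=> [/from_pR/all_true[]].
- by move=> /from_iR/all_true[].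
- by move=> /from_pR/all_true[].
- by move=> /from_iRc/all_true[].
- exact: from_pRc.
Qed.
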